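(* Let $\mathcal H$ be an infinite-dimensional separable Hilbert space and let $\{f_k\}_{k=1}^\infty$ be a frame for $\mathcal H$ with frame bounds $A,B>0$. Let $U:\ell^2(\mathbb N)\to\mathcal H$, $U\{c_k\}_{k=1}^\infty=\sum_{k=1}^\infty c_kf_k$, be its synthesis operator, with kernel $\mathcal N(U)$, and let $\mathcal T:\ell^2(\mathbb N)\to\ell^2(\mathbb N)$, $\mathcal T\{c_k\}_{k=1}^\infty=\{0,c_1,c_2,\dots\}$, be the right-shift operator. Then the following are equivalent: (i) The frame has a representation $\{f_k\}_{k=1}^\infty=\{T^nf_1\}_{n=0}^\infty$ (i.e. $f_{n+1}=T^nf_1$ for all $n\ge 0$) for some bounded linear operator $T:\mathcal H\to\mathcal H$. (ii) For some dual frame $\{g_k\}_{k=1}^\infty$ of $\{f_k\}_{k=1}^\infty$ (and hence for all dual frames), $$f_{j+1}=\sum_{k=1}^\infty\langle f_j,g_k\rangle f_{k+1}\quad\text{for all } j\in\mathbb N.$$ (iii) The kernel $\mathcal N(U)$ is invariant under $\mathcal T$, i.e. $\mathcal T(\mathcal N(U))\subseteq\mathcal N(U)$. In the affirmative case, letting $\{g_k\}_{k=1}^\infty$ denote an arbitrary dual frame of $\{f_k\}_{k=1}^\infty$, the operator $T$ has the form $$Tf=\sum_{k=1}^\infty\langle f,g_k\rangle f_{k+1}\quad\text{for all } f\in\mathcal H,$$ and $1\le\|T\|\le\sqrt{BA^{-1}}$.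
   Context: $\mathbb N=\{1,2,3,\dots\}$. A sequence $\{f_k\}_{k=1}^\infty$ in $\mathcal H$ is a frame for $\mathcal H$ with frame bounds $A,B>0$ if $A\|f\|^2\le\sum_{k=1}^\infty|\langle f,f_k\rangle|^2\le B\|f\|^2$ for all $f\in\mathcal H$. A dual frame of a frame $\{f_k\}_{k=1}^\infty$ is a frame $\{g_k\}_{k=1}^\infty$ for $\mathcal H$ such that $f=\sum_{k=1}^\infty\langle f,g_k\rangle f_k$ for all $f\in\mathcal H$. For a frame, the synthesis operator $U$ is well defined and bounded. Its kernel is $\mathcal N(U)=\{\{c_k\}_{k=1}^\infty\in\ell^2(\mathbb N):\sum_{k=1}^\infty c_kf_k=0\}$. *)

(* Defs.v *)
From HB Require Import structures.
From mathcomp Require Import all_boot all_order all_algebra.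
From mathcomp Require Import sesquilinear complex.
From mathcomp Require Import all_classical all_reals all_analysis.

Set Implicit Arguments.
Unset Strict Implicit.
Unset Printing Implicit Defensive.
Import Order.TTheory GRing.Theory Num.Theory.
Import numFieldNormedType.Exports.
Local Open Scope classical_set_scope.
Local Open Scope ring_scope.

(* The scalar field is either R or R[i], so that real and complex Hilbert     *)
(* spaces are treated uniformly.                                              *)
Inductive scalar_kind := RealScalars | ComplexScalars.

Definition scalar_field (R : realType) (F : scalar_kind) : numFieldType :=
  match F with
  | RealScalars => R
  | ComplexScalars => R[i]
  end.

Definition scalar_conj (R : realType) (F : scalar_kind) :
    {rmorphism scalar_field R F -> scalar_field R F} :=
  match F return {rmorphism scalar_field R F -> scalar_field R F} with
  | RealScalars => (@idfun R : {rmorphism R -> R})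
  | ComplexScalars => (@conjc R : {rmorphism R[i] -> R[i]})
  end.

Definition scalar_re (R : realType) (F : scalar_kind) : scalar_field R F -> R :=
  match F return scalar_field R F -> R with
  | RealScalars => id
  | ComplexScalars => @complex.Re R
  end.

(* `|x| lives in the scalar field, even when that field is R[i];              *)
(* nrm x is the same nonnegative number, seen in R.                           *)
Definition nrm (R : realType) (F : scalar_kind)
    (V : normedZmodType (scalar_field R F)) (x : V) : R :=
  scalar_re `|x|.

(* A Hilbert space is a complete normed module whose norm comes from an inner *)
(* product; forms are linear on the left and conjugate-linear on the right.   *)
Definition hilbert_norm (R : realType) (F : scalar_kind)
    (H : completeNormedModType (scalar_field R F))
    (form : {dot H for @scalar_conj R F}) : Prop :=
  forall x : H, `|x| ^+ 2 = form x x.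

Definition separable_space (T : topologicalType) : Prop :=
  exists2 D : set T, countable D & dense D.

Definition infinite_dimensional (K : fieldType) (V : lmodType K) : Prop :=
  ~ exists n (e : 'I_n -> V),
      forall x : V, exists c : 'I_n -> K, x = \sum_(i < n) c i *: e i.

Definition has_sum (K : numFieldType) (V : normedModType K)
    (u : nat -> V) (x : V) : Prop :=
  series u @ \oo --> x.

Section Frames.
Variables (R : realType) (F : scalar_kind).
Variable H : completeNormedModType (scalar_field R F).
Variable form : {dot H for @scalar_conj R F}.

(* Sequences are indexed from 0: f k stands for the (k+1)-st term f_{k+1}.    *)
Implicit Types (f g : nat -> H) (c : nat -> scalar_field R F).

Definition frame_with_bounds f (A B : R) : Prop :=
  [/\ 0 < A, 0 < B & forall x : H,
    ((A * nrm x ^+ 2)%:E <= \sum_(0 <= k <oo) (nrm (form x (f k)) ^+ 2)%:E /\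
     \sum_(0 <= k <oo) (nrm (form x (f k)) ^+ 2)%:E <= (B * nrm x ^+ 2)%:E)%E].

Definition is_frame f : Prop := exists A B : R, frame_with_bounds f A B.

Definition dual_frame f g : Prop :=
  is_frame g /\ forall x : H, has_sum (fun k => form x (g k) *: f k) x.

Definition ell2 : set (nat -> scalar_field R F) :=
  [set c | (\sum_(0 <= k <oo) (nrm (c k) ^+ 2)%:E < +oo)%E].

Definition synthesis_kernel f : set (nat -> scalar_field R F) :=
  [set c | ell2 c /\ has_sum (fun k => c k *: f k) 0].

Definition right_shift c : nat -> scalar_field R F :=
  fun n => if n is m.+1 then c m else 0.

Definition bounded_operator (T : H -> H) : Prop :=
  exists M : R, forall x : H, nrm (T x) <= M * nrm x.

(* sup is a genuine supremum when T is bounded (and 0 by convention if not).  *)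
Definition operator_norm (T : H -> H) : R :=
  sup [set nrm (T x) | x in [set x : H | nrm x <= 1]].

Definition represents (T : {linear H -> H}) f : Prop :=
  bounded_operator T /\ forall n, f n = iter n T (f 0%N).

End Frames.

(* Main.v *)
Require Import Defs.
From HB Require Import structures.
From mathcomp Require Import all_boot all_order all_algebra.
From mathcomp Require Import sesquilinear complex.
From mathcomp Require Import all_classical all_reals all_analysis.
From mathcomp Require Import ring lra.
Set Implicit Arguments.
Unset Strict Implicit.
Unset Printing Implicit Defensive.
Import Order.TTheory GRing.Theory Num.Theory.
Import numFieldNormedType.Exports.
Local Open Scope classical_set_scope.
Local Open Scope ring_scope.

(** Write S x = sum <x, f_k> f_k for the frame operator. The upper frame bound
    says exactly that synthesis is bounded: the square norm of sum c_k f_k is at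
    most B times the square l2-norm of c, and this survives dropping f_0 from
    the sequence, so sum c_k f_{k+1} makes sense for the same coefficients c
    and obeys the same bound. The lower bound makes S invertible, and then
    g_k = S^-1 f_k is a dual frame whose upper bound is 1/A
    ([canonical_dual]).

    If f_{k+1} = T f_k with T bounded, applying T term by term to
    x = sum <x, g_k> f_k gives T x = sum <x, g_k> f_{k+1} for every dual g
    ([represents_expansion]), and applying it to 0 = sum c_k f_k shows that the
    kernel is shift invariant ([represents_kernel]). Conversely the series
    sum <x, g_k> f_{k+1} defines a bounded operator for any dual g, and the
    shifted expansions say that it maps f_j to f_{j+1}
    ([shifted_expansion_represents]). Shift invariance of the kernel produces
    those expansions: f_j = sum <f_j, g_k> f_k means that the coefficients
    (<f_j, g_k>)_k differ from the j-th unit sequence by an element of the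
    kernel, and shifting that element yields the expansion of f_{j+1}
    ([kernel_shifted_expansion]).

    For the norm, inserting the canonical dual in the formula for T x gives
    |T x|^2 <= B * (1/A) |x|^2. If |T| < 1, the square norms of f_k = T^k f_0
    are summable, hence have a tail of sum less than A; in infinite dimension
    some x <> 0 is orthogonal to all the f_k outside that tail, and by
    Cauchy-Schwarz this x violates the lower frame bound
    ([operator_norm_ge1]).

    Real and complex scalars are handled at once: the norm takes values in the
    scalar field, so everything is transported to inequalities between the real
    numbers [nrm x] and [scalar_re z]. *)

(** * Scalars *)

Section Scalars.
Variables (R : realType) (F : scalar_kind).
Local Notation K := (scalar_field R F).
Local Notation re := (@scalar_re R F).
Local Notation conj := (@scalar_conj R F).

Definition of_real : R -> K :=
  match F return R -> scalar_field R F with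
  | RealScalars => id
  | ComplexScalars => @real_complex R
  end.

Lemma of_realK r : re (of_real r) = r.
Proof. by rewrite /scalar_re /of_real; case: F. Qed.

Lemma of_real_re (z : K) : 0 <= z -> of_real (re z) = z.
Proof.
rewrite /scalar_re /of_real; case: F z => //= -[a b].
by rewrite lecE /= => /andP[/eqP -> _].
Qed.

Lemma ler_of_real r s : (of_real r <= of_real s) = (r <= s).
Proof. by rewrite /of_real; case: F => //=; rewrite lecR. Qed.

Lemma ltr_of_real r s : (of_real r < of_real s) = (r < s).
Proof. by rewrite /of_real; case: F => //=; rewrite ltcR. Qed.

Lemma of_realM r s : of_real (r * s) = of_real r * of_real s.
Proof. by rewrite /of_real; case: F => //=; rewrite rmorphM. Qed.

Lemma of_realD r s : of_real (r + s) = of_real r + of_real s.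
Proof. by rewrite /of_real; case: F => //=; rewrite rmorphD. Qed.

Lemma of_real0 : of_real 0 = 0.
Proof. by rewrite /of_real; case: F. Qed.

Lemma of_real1 : of_real 1 = 1.
Proof. by rewrite /of_real; case: F. Qed.

Lemma conj_of_real r : conj (of_real r) = of_real r.
Proof. by rewrite /of_real; case: F => //=; rewrite oppr0. Qed.

Lemma reD z w : re (z + w) = re z + re w.
Proof. by rewrite /scalar_re; case: F z w => //= -[a b] [c d]. Qed.

Lemma reN z : re (- z) = - re z.
Proof. by rewrite /scalar_re; case: F z => //= -[a b]. Qed.

Lemma re0 : re 0 = 0.
Proof. by rewrite /scalar_re; case: F. Qed.

Lemma re_real_mul r z : re (of_real r * z) = r * re z.
Proof.
by rewrite /scalar_re /of_real; case: F z => //= -[a b] /=; rewrite mul0r subr0.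
Qed.

Lemma re_conj z : re (conj z) = re z.
Proof. by rewrite /scalar_re; case: F z => //= -[a b]. Qed.

Lemma mul_conj z : z * conj z = `|z| ^+ 2.
Proof.
case: F z => /= [z|z]; first by rewrite real_normK ?num_real.
by rewrite sqr_normc.
Qed.

Lemma norm_conj z : `|conj z| = `|z|.
Proof. by case: F z => //= -[a b]; rewrite !normc_def /= sqrrN. Qed.

Lemma re_le_norm z : re z <= re `|z|.
Proof.
rewrite /scalar_re; case: F z => /= [z|[a b]]; first exact: ler_norm.
rewrite (le_trans (ler_norm a))// -sqrtr_sqr ler_wsqrtr//.
by rewrite lerDl sqr_ge0.
Qed.

End Scalars.

(** * Real-valued norms and convergence *)

Section Norm.
Variables (R : realType) (F : scalar_kind).
Local Notation K := (scalar_field R F).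
Local Notation re := (@scalar_re R F).
Local Notation iota := (@of_real R F).
Variable V : normedModType K.
Implicit Types x y : V.

Lemma of_real_nrm x : iota (nrm x) = `|x|.
Proof. exact: of_real_re. Qed.

Lemma nrm_ge0 x : 0 <= nrm x.
Proof. by rewrite -(@ler_of_real R F) of_real0 of_real_nrm. Qed.

Lemma nrm0 : nrm (0 : V) = 0.
Proof. by rewrite /nrm normr0 re0. Qed.

Lemma nrm_eq0 x : nrm x = 0 -> x = 0.
Proof. by move=> x0; apply/normr0_eq0; rewrite -of_real_nrm x0 of_real0. Qed.

Lemma nrmD x y : nrm (x + y) <= nrm x + nrm y.
Proof. by rewrite -(@ler_of_real R F) of_realD !of_real_nrm ler_normD. Qed.

Lemma nrmN x : nrm (- x) = nrm x.
Proof. by rewrite /nrm normrN. Qed.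

Lemma nrmB x y : nrm (x - y) = nrm (y - x).
Proof. by rewrite /nrm distrC. Qed.

Lemma nrmZ (c : K) x : nrm (c *: x) = nrm c * nrm x.
Proof. by rewrite /nrm normrZ -(@of_real_re R F `|c|)// re_real_mul of_realK. Qed.

Lemma ler_nrm_dist x y : `|nrm x - nrm y| <= nrm (x - y).
Proof.
rewrite ler_norml; apply/andP; split.
  by have := nrmD (y - x) x; rewrite subrK nrmB; lra.
by have := nrmD (x - y) y; rewrite subrK; lra.
Qed.

Lemma nrm_scalar_of_real (r : R) : 0 <= r -> nrm (iota r : K) = r.
Proof.
by move=> r0; rewrite /nrm ger0_norm ?of_realK// -(of_real0 R F) ler_of_real.
Qed.

(** The scalar field carries the epsilons of the topology; this is what turns
    every limit in V into a limit of real numbers. *)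
Lemma cvg_nrmP (u : nat -> V) x :
  u @ \oo --> x <-> (fun n => nrm (u n - x)) @ \oo --> (0 : R).
Proof.
split => [/cvgrPdist_lt ux|/cvgrPdist_lt ux].
  apply/cvgrPdist_lt => e e0.
  have ie0 : 0 < iota e by rewrite -(of_real0 R F) ltr_of_real.
  near=> n.
  have : `|x - u n| < iota e by near: n; exact: ux.
  rewrite sub0r normrN ger0_norm ?nrm_ge0// nrmB -of_real_nrm.
  by rewrite ltr_of_real.
apply/cvgrPdist_lt => e e0.
have ie : iota (re e) = e by apply: of_real_re; exact: ltW.
have re0 : 0 < re e by rewrite -(@ltr_of_real R F) ie of_real0.
near=> n.
have : `|0 - nrm (u n - x)| < re e by near: n; exact: ux.
rewrite sub0r normrN ger0_norm ?nrm_ge0// nrmB -of_real_nrm -ie.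
by rewrite ltr_of_real of_realK.
Unshelve. all: by end_near. Qed.

Lemma cvg_nrm (u : nat -> V) x :
  u @ \oo --> x -> (fun n => nrm (u n)) @ \oo --> nrm x.
Proof.
move=> /cvg_nrmP/cvgrPdist_lt ux; apply/cvgrPdist_lt => e e0; near=> n.
rewrite distrC (le_lt_trans (ler_nrm_dist _ _))//.
have : `|0 - nrm (u n - x)| < e by near: n; exact: ux.
by rewrite sub0r normrN ger0_norm ?nrm_ge0.
Unshelve. all: by end_near. Qed.

End Norm.

Section ScalarNorm.
Variables (R : realType) (F : scalar_kind).
Local Notation K := (scalar_field R F).
Local Notation re := (@scalar_re R F).
Local Notation conj := (@scalar_conj R F).
Implicit Types z w : K.

Lemma nrmM z w : nrm (z * w) = nrm z * nrm w.
Proof. by rewrite /nrm normrM -(@of_real_re R F `|z|)// re_real_mul of_realK. Qed.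

Lemma re_mul_le z w : re (z * w) <= nrm z * nrm w.
Proof. by rewrite -nrmM; exact: re_le_norm. Qed.

Lemma nrm_conj z : nrm (conj z) = nrm z.
Proof. by rewrite /nrm norm_conj. Qed.

Lemma mul_conj_nrm z : z * conj z = of_real F (nrm z ^+ 2).
Proof. by rewrite mul_conj expr2 of_realM of_real_re// -expr2. Qed.

Lemma re_sum m n (a : nat -> K) :
  re (\sum_(m <= k < n) a k) = \sum_(m <= k < n) re (a k).
Proof. by rewrite (big_morph _ (@reD R F) (@re0 R F)). Qed.

End ScalarNorm.

(** * Inner products and Bessel sequences *)

Section Inner.
Variables (R : realType) (F : scalar_kind).
Local Notation K := (scalar_field R F).
Local Notation re := (@scalar_re R F).
Local Notation conj := (@scalar_conj R F).
Variable H : completeNormedModType K.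
Variable form : {dot H for @scalar_conj R F}.
Hypothesis H_hilbert : hilbert_norm form.
Implicit Types (x y : H).

Lemma formC x y : form x y = conj (form y x).
Proof. by rewrite (hermC form) expr0 mul1r. Qed.

Lemma formDl x y z : form (x + y) z = form x z + form y z.
Proof. exact: linearDl. Qed.

Lemma formZl c x z : form (c *: x) z = c * form x z.
Proof. exact: linearZl_LR. Qed.

Lemma form0l z : form 0 z = 0.
Proof. by have := formZl 0 0 z; rewrite scale0r mul0r. Qed.

Lemma formNl x z : form (- x) z = - form x z.
Proof. by rewrite -scaleN1r formZl mulN1r. Qed.

Lemma formBl x y z : form (x - y) z = form x z - form y z.
Proof. by rewrite formDl formNl. Qed.

Lemma form_suml m n (u : nat -> H) z :
  form (\sum_(m <= k < n) u k) z = \sum_(m <= k < n) form (u k) z.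
Proof. exact: (big_morph (form^~ z) (fun x y => formDl x y z) (form0l z)). Qed.

Lemma formBr x y z : form z (x - y) = form z x - form z y.
Proof. by rewrite formC formBl rmorphB /= -!formC. Qed.

Lemma formZr c x z : form z (c *: x) = conj c * form z x.
Proof. by rewrite formC formZl rmorphM /= -formC. Qed.

Lemma nrm_formC x y : nrm (form x y) = nrm (form y x).
Proof. by rewrite formC nrm_conj. Qed.

Lemma form_nrm x : form x x = of_real F (nrm x ^+ 2).
Proof. by rewrite -H_hilbert expr2 of_realM !of_real_nrm -expr2. Qed.

Lemma re_form_nrm x : re (form x x) = nrm x ^+ 2.
Proof. by rewrite form_nrm of_realK. Qed.

Lemma nrm_sqrB x y :
  nrm (x - y) ^+ 2 = nrm x ^+ 2 - 2 * re (form x y) + nrm y ^+ 2.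
Proof.
rewrite -!re_form_nrm formBl !formBr [form y x]formC.
rewrite !reD !reN !reD !reN re_conj; ring.
Qed.

(** Expand the square norm of z = |y|^2 x - <x,y> y, which is orthogonal to y;
    scaling by |y|^2 avoids a division. *)
Lemma cauchy_schwarz x y : nrm (form x y) <= nrm x * nrm y.
Proof.
have [y0|y0] := eqVneq (nrm y) 0.
  rewrite (nrm_eq0 y0) formC form0l rmorph0.
  by rewrite [nrm 0]/nrm normr0 re0 mulr_ge0 ?nrm_ge0.
have y_gt0 : 0 < nrm y by rewrite lt_def y0 nrm_ge0.
pose z := of_real F (nrm y ^+ 2) *: x - form x y *: y.
have : 0 <= re (form z z) by rewrite re_form_nrm sqr_ge0.
rewrite {2}/z formBr !formZr conj_of_real.
have -> : form z y = 0.
  by rewrite /z formBl !formZl form_nrm mulrC subrr.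
rewrite mulr0 subr0 re_real_mul /z formBl !formZl [form y x]formC mul_conj_nrm.
rewrite reD reN of_realK re_real_mul re_form_nrm.
rewrite pmulr_rge0 ?exprn_gt0// subr_ge0 -exprMn mulrC.
by rewrite ler_sqr ?nnegrE ?mulr_ge0 ?nrm_ge0.
Qed.

Lemma re_form_le x y : re (form x y) <= nrm x * nrm y.
Proof. exact: le_trans (re_le_norm _) (cauchy_schwarz x y). Qed.

Lemma form_ext x y : (forall z, form x z = form y z) -> x = y.
Proof.
move=> xy; apply/subr0_eq/nrm_eq0/eqP; rewrite -sqrf_eq0 -re_form_nrm.
by rewrite formBl xy subrr re0.
Qed.

(** The upper frame bound, on partial sums: this is the form in which it bounds
    finite linear combinations. *)
Definition bessel (f : nat -> H) (B : R) := forall x n,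
  \sum_(0 <= k < n) nrm (form x (f k)) ^+ 2 <= B * nrm x ^+ 2.

Lemma bessel_range f (B : R) x m n : bessel f B ->
  \sum_(m <= k < n) nrm (form x (f k)) ^+ 2 <= B * nrm x ^+ 2.
Proof.
move=> fB; apply: le_trans (fB x n).
have [mn|/ltnW nm] := leqP m n; last first.
  by rewrite big_geq// sumr_ge0// => *; rewrite sqr_ge0.
rewrite (@big_cat_nat _ _ _ m 0 n)//= lerDr.
by rewrite sumr_ge0// => *; rewrite sqr_ge0.
Qed.

(** With s = sum c_k f_k, |s|^2 = sum Re (c_k <f_k,s>). Splitting each term by
    2 B a b <= B^2 a^2 + b^2 leaves on the right a sum of |<s,f_k>|^2, which
    the Bessel bound absorbs into half of the left-hand side. *)
Lemma bessel_synthesis_le f (B : R) (c : nat -> K) m n : 0 < B -> bessel f B ->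
  nrm (\sum_(m <= k < n) c k *: f k) ^+ 2
    <= B * \sum_(m <= k < n) nrm (c k) ^+ 2.
Proof.
move=> B0 fB; set s := \sum_(m <= k < n) _.
have fs := bessel_range s m n fB.
have : B * (2 * nrm s ^+ 2) <= B * (B * \sum_(m <= k < n) nrm (c k) ^+ 2)
    + \sum_(m <= k < n) nrm (form s (f k)) ^+ 2.
  rewrite -{1}re_form_nrm {1}/s form_suml re_sum !mulr_sumr -big_split/=.
  apply: ler_sum => k _; rewrite formZl.
  have := re_mul_le (c k) (form (f k) s); rewrite [nrm (form (f k) s)]nrm_formC.
  have := sqr_ge0 (B * nrm (c k) - nrm (form s (f k))).
  move: (nrm (c k)) (nrm (form s (f k))) (scalar_re _) => a b r ab rab.
  have : B * r <= B * (a * b) by rewrite ler_pM2l.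
  by nra.
move=> h; have := le_trans h (lerD (lexx _) fs).
move: (nrm s ^+ 2) (\sum_(m <= k < n) _) => a b hab.
have : B * a <= B * (B * b) by lra.
by rewrite ler_pM2l.
Qed.

End Inner.

(** * Series of nonnegative reals *)

Section NonnegSeries.
Variable R : realType.
Implicit Types a : nat -> R.

Lemma bounded_nonneg_series_tail a M : (forall k, 0 <= a k) ->
  (forall n, \sum_(0 <= k < n) a k <= M) ->
  forall e, 0 < e -> exists N, forall m n, (N <= m)%N ->
    \sum_(m <= k < n) a k < e.
Proof.
move=> a0 aM e e0.
have nd : nondecreasing_seq (series a) by exact: nondecreasing_series.
have : cvgn (series a).
  by apply: nondecreasing_is_cvgn => //; exists M => _ [n _ <-]; exact: aM.
move=> /cvg_cauchy/cauchy_seriesP/(_ e e0)[[P Q] [[N1 _ PN] [N2 _ QN]]] PQ.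
exists (maxn N1 N2) => m n mN.
have [mn|nm] := leqP n m; first by rewrite big_geq.
apply: le_lt_trans (ler_norm _) _; apply: (PQ (m, n)); split => /=.
  by apply: PN => /=; rewrite (leq_trans (leq_maxl _ N2)).
by apply: QN => /=; rewrite (leq_trans (leq_maxr N1 _))// (leq_trans mN)// ltnW.
Qed.

Lemma nneseries_leP a M : (forall k, 0 <= a k) ->
  (\sum_(0 <= k <oo) (a k)%:E <= M%:E)%E <->
  forall n, \sum_(0 <= k < n) a k <= M.
Proof.
move=> a0; split=> [h n|h].
  rewrite -lee_fin -sumEFin (le_trans _ h)//.
  by apply: nneseries_lim_ge => k _ _; rewrite lee_fin.
apply: lime_le; first by apply: is_cvg_nneseries => n _ _; rewrite lee_fin.
by apply: nearW => n; rewrite sumEFin lee_fin.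
Qed.

Lemma nneseries_geP a l M : series a @ \oo --> l ->
  (M%:E <= \sum_(0 <= k <oo) (a k)%:E)%E <-> M <= l.
Proof.
move=> al; have -> : (\sum_(0 <= k <oo) (a k)%:E = l%:E)%E.
  apply: cvg_lim => //.
  under eq_fun do rewrite sumEFin.
  by apply: cvg_EFin; [exact: nearW | exact: al].
by rewrite lee_fin.
Qed.

Lemma nneseries_lt_pinfty a : (forall k, 0 <= a k) ->
  (\sum_(0 <= k <oo) (a k)%:E < +oo)%E ->
  exists M, forall n, \sum_(0 <= k < n) a k <= M.
Proof.
move=> a0 h; set s := (\sum_(0 <= k <oo) _)%E in h.
have s0 : (0 <= s)%E by apply: nneseries_ge0 => *; rewrite lee_fin.
exists (fine s); apply/nneseries_leP => //.
by rewrite fineK// ge0_fin_numE.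
Qed.

End NonnegSeries.

(** * Convergence of synthesis series *)

Section Convergence.
Variables (R : realType) (F : scalar_kind).
Local Notation K := (scalar_field R F).
Local Notation re := (@scalar_re R F).

Lemma cvg_le_nrm (V W : normedModType K) (u : nat -> V) x (w : nat -> W) y M :
  (forall n, nrm (w n - y) <= M * nrm (u n - x)) ->
  u @ \oo --> x -> w @ \oo --> y.
Proof.
move=> wu /cvg_nrmP ux; apply/cvg_nrmP.
apply: (@squeeze_cvgr _ _ _ _ (fun=> 0) (fun n => M * nrm (u n - x))).
- by apply: nearW => n; rewrite nrm_ge0 wu.
- exact: cvg_cst.
- by rewrite -[X in _ --> X](mulr0 M); apply: cvgMr.
Qed.

Lemma cvg_re (u : nat -> K) (z : K) :
  u @ \oo --> z -> (fun n => re (u n)) @ \oo --> re z.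
Proof.
move=> /(@cvg_nrmP _ _ K^o) uz.
apply/cvgrPdist_lt => e e0; near=> n.
have : `|0 - nrm (u n - z)| < e by near: n; move/cvgrPdist_lt: uz; exact.
rewrite sub0r normrN ger0_norm ?(@nrm_ge0 _ _ K^o)//; apply: le_lt_trans.
rewrite distrC -reN -reD ler_norml re_le_norm andbT lerNl -reN.
by rewrite (le_trans (re_le_norm _))// normrN.
Unshelve. all: by end_near. Qed.

Lemma nrm_series_cvg (V : completeNormedModType K) (u : nat -> V) :
  (forall e, 0 < e -> exists N, forall m n, (N <= m)%N ->
     nrm (\sum_(m <= k < n) u k) < e) ->
  cvgn (series u).
Proof.
move=> h; apply/cauchy_cvgP/cauchy_seriesP => e e0.
have ie : of_real F (re e) = e by apply: of_real_re; exact: ltW.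
have re0 : 0 < re e by rewrite -(@ltr_of_real R F) ie of_real0.
have [N hN] := h _ re0.
exists ([set m | (N <= m)%N], setT).
  by split; [exists N | exact: filterT].
by move=> [m n] [/= Nm _]; rewrite -of_real_nrm -ie ltr_of_real hN.
Qed.

End Convergence.

Section Bessel.
Variables (R : realType) (F : scalar_kind).
Local Notation K := (scalar_field R F).
Variable H : completeNormedModType K.
Variable form : {dot H for @scalar_conj R F}.
Hypothesis H_hilbert : hilbert_norm form.

Lemma cvg_forml (u : nat -> H) x y :
  u @ \oo --> x -> (fun n => form (u n) y : K) @ \oo --> (form x y : K).
Proof.
apply: (@cvg_le_nrm _ _ H K^o _ _ _ _ (nrm y)) => n.
by rewrite -formBl mulrC; exact: cauchy_schwarz.
Qed.

Lemma cvg_formr (u : nat -> H) x y :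
  u @ \oo --> x -> (fun n => form y (u n) : K) @ \oo --> (form y x : K).
Proof.
apply: (@cvg_le_nrm _ _ H K^o _ _ _ _ (nrm y)) => n.
by rewrite -formBr; exact: cauchy_schwarz.
Qed.

Variables (f : nat -> H) (B : R).
Hypotheses (B_gt0 : 0 < B) (f_bessel : bessel form f B).

Lemma bessel_synthesis_cvg (c : nat -> K) (M : R) :
  (forall n, \sum_(0 <= k < n) nrm (c k) ^+ 2 <= M) ->
  cvgn (series (fun k => c k *: f k)).
Proof.
move=> cM; apply: nrm_series_cvg => e e0.
have [||N hN] := @bounded_nonneg_series_tail R _ M _ cM (e ^+ 2 / B).
- by move=> k; rewrite sqr_ge0.
- by rewrite divr_gt0// exprn_gt0.
exists N => m n Nm.
rewrite -ltr_sqr ?nnegrE ?nrm_ge0 ?(ltW e0)//.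
apply: le_lt_trans (bessel_synthesis_le H_hilbert c m n B_gt0 f_bessel) _.
by rewrite mulrC -ltr_pdivlMr// hN.
Qed.

Lemma bessel_synthesis_bound (c : nat -> K) (M : R) x :
  (forall n, \sum_(0 <= k < n) nrm (c k) ^+ 2 <= M) ->
  has_sum (fun k => c k *: f k) x -> nrm x ^+ 2 <= B * M.
Proof.
move=> cM /cvg_nrm sx.
have sx2 : (fun n => nrm (series (fun k => c k *: f k) n) ^+ 2) @ \oo
    --> nrm x ^+ 2 by exact: (cvgM sx sx).
apply: (cvgr_to_le sx2).
apply: nearW => n.
apply: le_trans (bessel_synthesis_le H_hilbert c 0 n B_gt0 f_bessel) _.
by rewrite ler_pM2l.
Qed.

End Bessel.

(** * The frame operator and the canonical dual *)

Section FrameOperator.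
Variables (R : realType) (F : scalar_kind).
Local Notation K := (scalar_field R F).
Local Notation re := (@scalar_re R F).
Variable H : completeNormedModType K.
Variable form : {dot H for @scalar_conj R F}.
Hypothesis H_hilbert : hilbert_norm form.
Variables (f : nat -> H) (A B : R).
Hypothesis f_frame : frame_with_bounds form f A B.
Implicit Types x y z : H.

Lemma frame_bessel : bessel form f B.
Proof.
by case: f_frame => _ _ h x n; have [_ /nneseries_leP] := h x; apply => k;
  rewrite sqr_ge0.
Qed.

Let A_gt0 : 0 < A. Proof. by case: f_frame. Qed.
Let B_gt0 : 0 < B. Proof. by case: f_frame. Qed.

Definition frame_op x : H := limn (series (fun k => form x (f k) *: f k)).
Local Notation S := frame_op.

Lemma frame_op_sum x : has_sum (fun k => form x (f k) *: f k) (S x).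
Proof.
by apply: (bessel_synthesis_cvg H_hilbert B_gt0 frame_bessel) => n;
  exact: frame_bessel.
Qed.

(** Both sides are limits of the same finite sums of <x,f_k> <f_k,y>. *)
Lemma frame_op_sym x y : form (S x) y = form x (S y).
Proof.
have hx := cvg_forml H_hilbert (y := y) (@frame_op_sum x).
have hy := cvg_formr H_hilbert (y := x) (@frame_op_sum y).
apply: (cvg_unique (@norm_hausdorff _ K^o) hx).
suff -> : (fun n => form (series (fun k => form x (f k) *: f k) n) y)
  = (fun n => form x (series (fun k => form y (f k) *: f k) n)) by [].
apply/funext => n; rewrite [RHS]formC /series/= !form_suml rmorph_sum/=.
apply: eq_bigr => k _.
by rewrite !formZl rmorphM/= -!formC mulrC.
Qed.

(** Pairing the partial sums of S x with x gives the partial sums of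
    |<x,f_k>|^2, so the frame inequalities become operator inequalities
    for S. *)
Lemma frame_op_energy x :
  series (fun k => nrm (form x (f k)) ^+ 2) @ \oo --> re (form (S x) x).
Proof.
have := cvg_re (cvg_forml H_hilbert (y := x) (@frame_op_sum x)).
suff -> : (fun n => re (form (series (fun k => form x (f k) *: f k) n) x))
  = series (fun k => nrm (form x (f k)) ^+ 2) by [].
apply/funext => n; rewrite /series/= form_suml re_sum.
apply: eq_bigr => k _.
by rewrite formZl [form (f k) x]formC mul_conj_nrm of_realK.
Qed.

Lemma frame_op_ge x : A * nrm x ^+ 2 <= re (form (S x) x).
Proof.
apply/(nneseries_geP _ (@frame_op_energy x)).
by case: f_frame => _ _ /(_ x)[].
Qed.

Lemma frame_op_partial_energy x n :
  \sum_(0 <= k < n) nrm (form x (f k)) ^+ 2 <= re (form (S x) x).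
Proof.
rewrite -(cvg_lim _ (@frame_op_energy x))//.
apply: nondecreasing_cvgn_le.
  by apply: nondecreasing_series => k _ _; rewrite sqr_ge0.
by apply/cvg_ex; exists (re (form (S x) x)); exact: frame_op_energy.
Qed.

(** S x is the synthesis of the coefficients <x,f_k>, of square l2-norm
    <S x, x>: this sharpens |S| <= B and gives both the contraction
    estimate and the lower bound of the canonical dual. *)
Lemma frame_op_le x : nrm (S x) ^+ 2 <= B * re (form (S x) x).
Proof.
exact: (bessel_synthesis_bound H_hilbert B_gt0 frame_bessel
  (frame_op_partial_energy x) (@frame_op_sum x)).
Qed.

(** Linearity of S comes for free from its symmetry. *)
Lemma frame_opB x y : S (x - y) = S x - S y.
Proof.
by apply: (form_ext H_hilbert) => z; rewrite formBl !frame_op_sym formBl.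
Qed.

Lemma frame_opZ c x : S (c *: x) = c *: S x.
Proof.
by apply: (form_ext H_hilbert) => z; rewrite formZl !frame_op_sym formZl.
Qed.

Lemma frame_op_lipschitz x : nrm (S x) <= B * nrm x.
Proof.
have := frame_op_le x; have := re_form_le H_hilbert (S x) x.
have := nrm_ge0 (S x); have := nrm_ge0 x; have := B_gt0.
move: (nrm (S x)) (nrm x) (re _) => s t r B0 t0 s0 rs.
have [->|sN0] := eqVneq s 0; first by rewrite mulr_ge0 // ltW.
have s1 : 0 < s by rewrite lt_neqAle eq_sym sN0.
move=> h; rewrite -(ler_pM2l s1); apply: le_trans h _.
by rewrite mulrCA ler_pM2l.
Qed.

Lemma frame_op_coercive x : A * nrm x <= nrm (S x).
Proof.
have := frame_op_ge x; have := re_form_le H_hilbert (S x) x.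
have := nrm_ge0 (S x); have := nrm_ge0 x.
move: (nrm (S x)) (nrm x) (re _) => s t r t0 s0 rs.
have [->|tN0] := eqVneq t 0; first by rewrite mulr0.
have t1 : 0 < t by rewrite lt_neqAle eq_sym tN0.
move=> h; rewrite -(ler_pM2r t1); apply: le_trans rs.
by rewrite -mulrA -expr2.
Qed.

(** Richardson iteration for S y = x: the residuals r_{n+1} = r_n - S r_n / B
    satisfy (A/B) |r_n|^2 <= |r_n|^2 - |r_{n+1}|^2, so their square norms are
    summable and r_n tends to 0. The increments of the iterates are r_n / B,
    and S maps the difference of two iterates to a difference of residuals;
    since S is bounded below, the iterates are Cauchy. *)
Lemma frame_op_surj x : exists y, S y = x.
Proof.
pose lam : K := of_real F B^-1.
pose r n := iter n (fun z => z - lam *: S z) x.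
have rS n : r n.+1 = r n - lam *: S (r n) by [].
have r_dec n : (A / B) * nrm (r n) ^+ 2 <= nrm (r n) ^+ 2 - nrm (r n.+1) ^+ 2.
  rewrite rS (nrm_sqrB H_hilbert) formZr conj_of_real re_real_mul nrmZ exprMn.
  rewrite nrm_scalar_of_real ?invr_ge0 ?(ltW B_gt0)// [form _ (S _)]formC re_conj.
  have := frame_op_ge (r n); have := frame_op_le (r n).
  set s := nrm (S _); set t := nrm (r n); set e := re _ => hs ht.
  have : B^-1 ^+ 2 * s ^+ 2 <= B^-1 * e.
    rewrite expr2 -mulrA ler_pM2l ?invr_gt0//.
    by rewrite ler_pdivrMl.
  have : A / B * t ^+ 2 <= B^-1 * e.
    by rewrite [A / B]mulrC -mulrA ler_pM2l ?invr_gt0.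
  lra.
have r_sum n : \sum_(0 <= k < n) nrm (r k) ^+ 2 <= B / A * nrm x ^+ 2.
  rewrite -ler_pdivrMl ?divr_gt0// invf_div mulr_sumr.
  apply: (@le_trans _ _ (\sum_(0 <= k < n) (nrm (r k) ^+ 2 - nrm (r k.+1) ^+ 2))).
    exact: ler_sum.
  rewrite (eq_bigr (fun k => - nrm (r k.+1) ^+ 2 - - nrm (r k) ^+ 2)).
    rewrite (telescope_sumr (fun k => - nrm (r k) ^+ 2))// opprK addrC.
    by rewrite lerBlDr lerDl sqr_ge0.
  by move=> k _; rewrite opprK addrC.
have r_small e : 0 < e -> exists N, forall n, (N <= n)%N -> nrm (r n) < e.
  move=> e0; have [||N hN] := @bounded_nonneg_series_tail R _ _ _ r_sum (e ^+ 2).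
  - by move=> k; rewrite sqr_ge0.
  - by rewrite exprn_gt0.
  exists N => n /(hN _ n.+1); rewrite big_nat1.
  by rewrite ltr_sqr ?nnegrE ?nrm_ge0 ?ltW.
have S0 : S 0 = 0 by rewrite -[X in S X](subrr 0) frame_opB subrr.
have SD a b : S (a + b) = S a + S b.
  by rewrite -[b in LHS]opprK frame_opB -[- b]sub0r frame_opB S0 sub0r opprK.
(* S applied to the increments telescopes, since S (r_k / B) = r_k - r_{k+1} *)
have Ssum m n : (m <= n)%N -> S (\sum_(m <= k < n) lam *: r k) = r m - r n.
  move=> mn; rewrite (big_morph S SD S0).
  rewrite (eq_bigr (fun k => - r k.+1 - - r k)).
    by rewrite (telescope_sumr (fun k => - r k))// opprK addrC.
  by move=> k _; rewrite rS frame_opZ opprB opprK subrK.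
have /cvg_ex[l yl] : cvgn (series (fun k => lam *: r k)).
  apply: nrm_series_cvg => e e0.
  have [|N hN] := r_small (A * e / 2); first by rewrite divr_gt0 ?mulr_gt0.
  exists N => m n Nm.
  have [nm|/ltnW mn] := leqP n m; first by rewrite big_geq// nrm0.
  rewrite -(ltr_pM2l A_gt0); apply: le_lt_trans (frame_op_coercive _) _.
  rewrite Ssum//; have := nrmD (r m) (- r n); rewrite nrmN.
  have := hN _ Nm; have := hN _ (leq_trans Nm mn); lra.
exists l; have Sy : S (series (fun k => lam *: r k) n) @[n --> \oo] --> S l.
  apply: (cvg_le_nrm (M := B)) yl => n.
  by rewrite -frame_opB frame_op_lipschitz.
apply: (cvg_unique _ Sy); first exact: norm_hausdorff.
apply/cvg_nrmP/cvgrPdist_lt => e e0; have [N hN] := r_small _ e0.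
exists N => // n /= Nn; rewrite sub0r normrN ger0_norm ?nrm_ge0//.
by rewrite /series/= Ssum// -[r 0%N]/x addrAC subrr sub0r nrmN hN.
Qed.

(** With P the inverse of S, <x, P f_k> = <P x, f_k>, so the square l2-norm of
    the coefficients is <S P x, P x> = <x, P x>. The bound <x, P x> <= |x|^2 / A
    comes from expanding |x - A P x|^2 >= 0 and A |P x|^2 <= <x, P x>. *)
Lemma canonical_dual : exists g, dual_frame form f g /\ bessel form g A^-1.
Proof.
have [P SP] : exists P : H -> H, forall x, S (P x) = x.
  by exists (fun x => projT1 (cid (frame_op_surj x))) => x; case: cid.
have formP x k : form x (P (f k)) = form (P x) (f k).
  by rewrite -[x in LHS]SP frame_op_sym SP.
have P_le x : re (form x (P x)) <= A^-1 * nrm x ^+ 2.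
  have := frame_op_ge (P x); rewrite SP => h.
  have := sqr_ge0 (nrm (x - of_real F A *: P x)).
  rewrite (nrm_sqrB H_hilbert) formZr conj_of_real re_real_mul nrmZ exprMn.
  rewrite nrm_scalar_of_real ?(ltW A_gt0)// ler_pdivlMl//.
  have : A * (A * nrm (P x) ^+ 2) <= A * re (form x (P x)) by rewrite ler_pM2l.
  lra.
have P_ge x : B^-1 * nrm x ^+ 2 <= re (form x (P x)).
  by have := frame_op_le (P x); rewrite SP ler_pdivrMl.
have g_bessel : bessel form (fun k => P (f k)) A^-1.
  move=> x n; under eq_bigr do rewrite formP.
  by rewrite (le_trans (frame_op_partial_energy _ _))// SP.
exists (fun k => P (f k)); split=> //; split.
  exists B^-1, A^-1; split; rewrite ?invr_gt0// => x; split.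
    have := @frame_op_energy (P x); rewrite SP => h.
    under eq_eseriesr do rewrite formP.
    exact/(nneseries_geP _ h).
  by apply/nneseries_leP => [k|n]; [rewrite sqr_ge0 | exact: g_bessel].
move=> x; rewrite -[X in has_sum _ X]SP.
under [X in has_sum X _]eq_fun do rewrite formP.
exact: frame_op_sum.
Qed.

End FrameOperator.

(** * Shifted expansions and the kernel of synthesis *)

Section Shift.
Variables (R : realType) (F : scalar_kind).
Local Notation K := (scalar_field R F).
Variable H : completeNormedModType K.
Variable form : {dot H for @scalar_conj R F}.
Hypothesis H_hilbert : hilbert_norm form.

Lemma bessel_shift (f : nat -> H) (B : R) :
  bessel form f B -> bessel form (fun k => f k.+1) B.
Proof.
move=> fB x n; apply: le_trans (fB x n.+1).
by rewrite [leRHS]big_nat_recl// lerDr sqr_ge0.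
Qed.

Lemma dual_frame_bessel (f g : nat -> H) : dual_frame form f g ->
  exists B, bessel form g B.
Proof. by move=> [[A [B gAB]] _]; exists B; exact: frame_bessel gAB. Qed.

Lemma has_sum_unique (u : nat -> H) x y : has_sum u x -> has_sum u y -> x = y.
Proof. by move=> ux uy; apply: (cvg_unique _ ux uy); exact: norm_hausdorff. Qed.

Lemma has_sum_linear (a : K) (u v : nat -> H) x y :
  has_sum u x -> has_sum v y -> has_sum (fun k => a *: u k + v k) (a *: x + y).
Proof.
move=> ux vy; rewrite /has_sum.
have -> : series (fun k => a *: u k + v k)
    = (fun n => a *: series u n + series v n).
  by apply/funext => n; rewrite /series/= big_split/= scaler_sumr.
by apply: cvgD => //; exact: cvgZr.
Qed.

Lemma bounded_has_sum (T : {linear H -> H}) (u : nat -> H) x :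
  bounded_operator T -> has_sum u x -> has_sum (fun k => T (u k)) (T x).
Proof.
move=> [M TM]; apply: (@cvg_le_nrm _ _ _ _ _ _ _ _ M) => n.
rewrite /series/=; have -> : \sum_(0 <= k < n) T (u k)
  = T (\sum_(0 <= k < n) u k) by rewrite linear_sum.
by rewrite -linearB TM.
Qed.

Lemma represents_step (T : {linear H -> H}) (f : nat -> H) n :
  represents T f -> f n.+1 = T (f n).
Proof. by move=> [_ fT]; rewrite fT iterS -fT. Qed.

(** Term by term image under T of the reconstruction of x. *)
Lemma represents_expansion (T : {linear H -> H}) (f g : nat -> H) x :
  represents T f -> dual_frame form f g ->
  has_sum (fun k => form x (g k) *: f k.+1) (T x).
Proof.
move=> Tf [_ fg].
have := bounded_has_sum Tf.1 (fg x).
by under [X in has_sum X]eq_fun do rewrite linearZ/= -(represents_step _ Tf).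
Qed.

(** The series defining T converges for all x because the coefficients are
    square summable and the sequence without its first term is still Bessel. *)
Lemma shifted_expansion_represents (f g : nat -> H) (B : R) :
  0 < B -> bessel form f B -> dual_frame form f g ->
  (forall j, has_sum (fun k => form (f j) (g k) *: f k.+1) (f j.+1)) ->
  exists T : {linear H -> H}, represents T f.
Proof.
move=> B0 /bessel_shift fB fg fj.
have [B' gB'] := dual_frame_bessel fg.
pose T x : H := limn (series (fun k => form x (g k) *: f k.+1)).
have T_sum x : has_sum (fun k => form x (g k) *: f k.+1) (T x).
  by apply: (bessel_synthesis_cvg H_hilbert B0 fB) => n; exact: gB'.
have T_lin : linear T.
  move=> a x y; apply: has_sum_unique (T_sum _) _.
  have := has_sum_linear (a := a) (T_sum x) (T_sum y).
  by under eq_fun do rewrite scalerA -scalerDl -formZl -formDl.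
have T_bnd x : nrm (T x) ^+ 2 <= B * (B' * nrm x ^+ 2).
  exact: (bessel_synthesis_bound H_hilbert B0 fB (gB' x) (T_sum x)).
pose TL : {linear H -> H} := HB.pack T (GRing.isLinear.Build _ _ _ _ T T_lin).
exists TL; split.
  exists (Num.sqrt (B * `|B'|)) => x.
  rewrite -ler_sqr ?nnegrE ?mulr_ge0 ?sqrtr_ge0 ?nrm_ge0//.
  rewrite exprMn sqr_sqrtr; last by rewrite mulr_ge0// ltW.
  apply: le_trans (T_bnd x) _; rewrite -mulrA ler_pM2l// ler_wpM2r ?sqr_ge0//.
  exact: ler_norm.
elim=> [//|n IHn]; rewrite iterS -IHn.
exact: has_sum_unique (fj n) (T_sum _).
Qed.

Lemma right_shift_has_sum (f : nat -> H) (c : nat -> K) x :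
  has_sum (fun k => right_shift c k *: f k) x <->
  has_sum (fun k => c k *: f k.+1) x.
Proof.
suff e : (fun n => series (fun k => right_shift c k *: f k) (n + 1)%N)
    = series (fun k => c k *: f k.+1).
  by rewrite /has_sum -e (cvg_shiftn 1%N).
apply/funext => n; rewrite addn1 /series/= big_nat_recl//= scale0r add0r //.
Qed.

Lemma ell2_right_shift (c : nat -> K) :
  @ell2 R F c -> @ell2 R F (right_shift c).
Proof.
move=> /nneseries_lt_pinfty[k|M cM]; first exact: sqr_ge0.
apply: (@le_lt_trans _ _ M%:E); last exact: ltry.
apply/nneseries_leP => [k|[|n]]; first exact: sqr_ge0.
  by rewrite big_geq// (le_trans _ (cM 0%N))// big_geq.
by rewrite big_nat_recl//= [X in X ^+ 2]/nrm normr0 re0 expr0n add0r.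
Qed.

Lemma represents_kernel (T : {linear H -> H}) (f : nat -> H) :
  represents T f ->
  @right_shift R F @` synthesis_kernel f `<=` synthesis_kernel f.
Proof.
move=> Tf _ [c [c2 cf] <-]; split; first exact: ell2_right_shift.
apply/right_shift_has_sum.
have := bounded_has_sum Tf.1 cf; rewrite linear0.
by under [X in has_sum X]eq_fun do rewrite linearZ/= -(represents_step _ Tf).
Qed.

Lemma has_sum_single j (h : nat -> H) :
  has_sum (fun k => (if k == j then 1 else 0 : K) *: h k) (h j).
Proof.
apply: cvg_near_cst; exists j.+1 => // n /= jn.
rewrite /series/= (bigD1_seq j)/= ?mem_index_iota ?iota_uniq// eqxx scale1r.
by rewrite big1 ?addr0// => i /negbTE ->; rewrite scale0r.
Qed.

Lemma ell2_sub (c d : nat -> K) M N :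
  (forall n, \sum_(0 <= k < n) nrm (c k) ^+ 2 <= M) ->
  (forall n, \sum_(0 <= k < n) nrm (d k) ^+ 2 <= N) ->
  @ell2 R F (fun k => c k - d k).
Proof.
move=> cM dN; apply: (@le_lt_trans _ _ (2 * M + 2 * N)%:E); last exact: ltry.
apply/nneseries_leP => [k|n]; first exact: sqr_ge0.
apply: le_trans (lerD (ler_wpM2l _ (cM n)) (ler_wpM2l _ (dN n))); rewrite ?ler0n//.
rewrite !mulr_sumr -big_split/=; apply: ler_sum => k _.
have := @nrmD _ _ K^o (c k) (- d k); rewrite [nrm (- _)](@nrmN _ _ K^o).
have := @nrm_ge0 _ _ K^o (c k - d k).
move: (nrm (c k - d k)) (nrm (c k)) (nrm (d k)) => s a b s0 sab.
have : s ^+ 2 <= (a + b) ^+ 2 by rewrite ler_sqr// nnegrE// (le_trans s0).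
have := sqr_ge0 (a - b); nra.
Qed.

(** Reconstruction of f_j puts the coefficients <f_j,g_k> minus the j-th unit
    sequence in the kernel; shifting this element is the claim. *)
Lemma kernel_shifted_expansion (f g : nat -> H) : dual_frame form f g ->
  @right_shift R F @` synthesis_kernel f `<=` synthesis_kernel f ->
  forall j, has_sum (fun k => form (f j) (g k) *: f k.+1) (f j.+1).
Proof.
move=> fg kerT j.
have [B' gB'] := dual_frame_bessel fg.
pose e k : K := if k == j then 1 else 0.
pose d k : K := - e k + form (f j) (g k).
have d_ker : synthesis_kernel f d.
  split.
    have -> : d = (fun k => form (f j) (g k) - e k).
      by apply/funext => k; rewrite /d addrC.
    apply: (ell2_sub (gB' (f j)) (N := 1)) => n.
    rewrite (eq_bigr (fun k => if k == j then 1 else 0)).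
      by rewrite -big_mkcond big_nat1_eq; case: ifP.
    move=> k _; rewrite /e; case: eqP => _.
      by rewrite /nrm normr1 -(of_real1 R F) of_realK expr1n.
    by rewrite /nrm normr0 re0 expr0n.
  have := has_sum_linear (a := (-1)) (@has_sum_single j f) (fg.2 (f j)).
  rewrite scaleN1r addNr.
  by under eq_fun do rewrite scaleN1r -scaleNr -scalerDl.
have := kerT _ (ex_intro2 _ _ d d_ker erefl) => -[_ /right_shift_has_sum].
move=> /(has_sum_linear (a := 1) (@has_sum_single j (fun k => f k.+1))).
rewrite scale1r addr0.
by under eq_fun do rewrite scale1r -scalerDl /d /e addNKr.
Qed.

End Shift.

(** * Bounds on the operator norm *)

Section OperatorNorm.
Variables (R : realType) (F : scalar_kind).
Local Notation K := (scalar_field R F).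
Variable H : completeNormedModType K.
Variable form : {dot H for @scalar_conj R F}.
Hypothesis H_hilbert : hilbert_norm form.

Lemma operator_norm_ub (T : {linear H -> H}) x : bounded_operator T ->
  nrm (T x) <= operator_norm T * nrm x.
Proof.
move=> [M TM].
have [x0|x0] := eqVneq (nrm x) 0.
  by rewrite (nrm_eq0 x0) linear0 nrm0 mulr0.
have x_gt0 : 0 < nrm x by rewrite lt_def x0 nrm_ge0.
pose y := of_real F (nrm x)^-1 *: x.
have iK : nrm (of_real F (nrm x)^-1) = (nrm x)^-1.
  by rewrite nrm_scalar_of_real// invr_ge0 ltW.
have y1 : nrm y = 1 by rewrite nrmZ iK mulVf.
rewrite -ler_pdivrMr// mulrC -iK -nrmZ -linearZ.
apply: ub_le_sup; last by exists y => //=; rewrite y1.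
exists `|M| => _ [z /= z1 <-]; apply: le_trans (TM z) _.
rewrite (le_trans (ler_wpM2r (nrm_ge0 _) (ler_norm M)))//.
by rewrite -[leRHS]mulr1 ler_wpM2l.
Qed.

Lemma operator_norm_le (T : {linear H -> H}) M : 0 <= M ->
  (forall x, nrm (T x) <= M * nrm x) -> operator_norm T <= M.
Proof.
move=> M0 TM; apply: ge_sup.
  by exists (nrm (T 0)); exists 0 => //=; rewrite nrm0.
move=> _ [z /= z1 <-]; apply: le_trans (TM z) _.
by rewrite -[leRHS]mulr1 ler_wpM2l.
Qed.

(** Gram-Schmidt without assuming linear independence: f_n is first replaced by
    its component w orthogonal to the previous terms. When w = 0 the quotient
    <z,w> / <w,w> is 0, so that case needs no separate formula. *)
Lemma orthogonal_decomposition (f : nat -> H) n x :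
  exists c : nat -> K, forall i, (i < n)%N ->
    form (x - \sum_(0 <= k < n) c k *: f k) (f i) = 0.
Proof.
elim: n x => [|n IHn] x; first by exists (fun=> 0).
have [c' w_orth] := IHn (f n); set w := f n - _ in w_orth.
have [c z_orth] := IHn x; set z := x - _ in z_orth.
pose d := form z w / form w w.
exists (fun k => if k == n then d else c k - d * c' k) => i.
have -> : x - \sum_(0 <= k < n.+1) (if k == n then d else c k - d * c' k) *: f k
    = z - d *: w.
  rewrite big_nat_recr//= eqxx.
  rewrite (eq_big_nat _ _ (F2 := fun k => c k *: f k - d *: (c' k *: f k))).
    rewrite sumrB -scaler_sumr /z /w scalerBr.
    move: (\sum_(0 <= k < n) c k *: f k) => a.
    by rewrite opprD !opprB !addrA [x + _ - a]addrAC.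
  by move=> k /andP[_ kn]; rewrite ltn_eqF// scalerBl scalerA.
have zw_orth j : (j < n)%N -> form (z - d *: w) (f j) = 0.
  by move=> jn; rewrite formBl formZl z_orth// w_orth// mulr0 subr0.
rewrite ltnS leq_eqVlt => /orP[/eqP ->|]; last exact: zw_orth.
have -> : f n = w + \sum_(0 <= k < n) c' k *: f k by rewrite subrK.
rewrite formC formDl form_suml big_nat big1 => [|k /andP[_ kn]]; last first.
  by rewrite formZl formC zw_orth// rmorph0 mulr0.
rewrite addr0 -formC formBl formZl /d.
have [w0|w0] := eqVneq (form w w) 0; last by rewrite divfK ?subrr.
have -> : w = 0 by apply/nrm_eq0/eqP; rewrite -sqrf_eq0 -(re_form_nrm H_hilbert) w0 re0.
by rewrite formC form0l rmorph0 !mul0r subrr.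
Qed.

(** Otherwise every orthogonal component vanishes and f_0, ..., f_{n-1} span
    the space. *)
Lemma exists_orthogonal (f : nat -> H) n : infinite_dimensional H ->
  exists2 x, x != 0 & forall k, (k < n)%N -> form x (f k) = 0.
Proof.
move=> H_inf; apply: contrapT => no_orth; apply: H_inf.
exists n, (fun i => f i) => x.
have [c x_orth] := orthogonal_decomposition f n x.
exists (fun i => c i); rewrite -(big_mkord xpredT (fun k => c k *: f k)).
apply/subr0_eq/eqP/negPn/negP => x0; apply: no_orth.
by exists (x - \sum_(0 <= k < n) c k *: f k).
Qed.

(** A strict contraction T makes sum |f_k|^2 finite, which is incompatible with
    the lower frame bound in infinite dimension: test it on a vector orthogonal
    to all f_k outside a tail of sum less than A / 2. *)
Lemma operator_norm_ge1 (T : {linear H -> H}) (f : nat -> H) (A B : R) :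
  infinite_dimensional H -> frame_with_bounds form f A B -> represents T f ->
  1 <= operator_norm T.
Proof.
move=> H_inf [A0 _ fA] Tf; rewrite leNgt; apply/negP => q1.
set q := operator_norm T in q1.
have Tq x : nrm (T x) <= q * nrm x by exact: operator_norm_ub Tf.1.
have q0 : 0 <= q.
  (* the instance n = 0 provides a nonzero vector, whence the sign of q *)
  have [x x0 _] := exists_orthogonal f 0 H_inf.
  have x_gt0 : 0 < nrm x.
    by rewrite lt_def nrm_ge0 andbT; apply: contraNneq x0 => /nrm_eq0 ->.
  by rewrite -(pmulr_lge0 _ x_gt0) (le_trans _ (Tq x))// nrm_ge0.
have f_sum n : \sum_(0 <= k < n) nrm (f k) ^+ 2
    <= (1 - q ^+ 2)^-1 * nrm (f 0%N) ^+ 2.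
  have qq : 0 < 1 - q ^+ 2 by rewrite subr_gt0 expr_lt1.
  rewrite ler_pdivlMl// mulr_sumr.
  apply: (@le_trans _ _ (\sum_(0 <= k < n) (- nrm (f k.+1) ^+ 2 - - nrm (f k) ^+ 2))).
    apply: ler_sum => k _; rewrite (represents_step _ Tf) opprK.
    have : nrm (T (f k)) ^+ 2 <= (q * nrm (f k)) ^+ 2.
      by rewrite ler_sqr ?nnegrE ?mulr_ge0 ?nrm_ge0.
    by rewrite exprMn; lra.
  rewrite (telescope_sumr (fun k => - nrm (f k) ^+ 2))// opprK addrC.
  by rewrite lerBlDr lerDl sqr_ge0.
have [||N hN] := @bounded_nonneg_series_tail R _ _ _ f_sum (A / 2).
- by move=> k; rewrite sqr_ge0.
- by rewrite divr_gt0.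
have [x x0 x_orth] := exists_orthogonal f N H_inf.
have x_gt0 : 0 < nrm x.
  by rewrite lt_def nrm_ge0 andbT; apply: contraNneq x0 => /nrm_eq0 ->.
have : (\sum_(0 <= k <oo) (nrm (form x (f k)) ^+ 2)%:E
    <= (nrm x ^+ 2 * (A / 2))%:E)%E.
  apply/nneseries_leP => [k|n]; first exact: sqr_ge0.
  apply: (@le_trans _ _ (\sum_(N <= k < n) nrm (form x (f k)) ^+ 2)).
    have [Nn|/ltnW nN] := leqP N n.
      rewrite (big_cat_nat (n := N))//= big_nat big1 ?add0r// => k /andP[_ kN].
      by rewrite x_orth// /nrm normr0 re0 expr0n.
    rewrite big_nat big1 ?sumr_ge0// => k.
      by rewrite sqr_ge0.
    by move=> /andP[_ kn]; rewrite x_orth ?(leq_trans kn)// /nrm normr0 re0 expr0n.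
  apply: le_trans (ler_wpM2l (sqr_ge0 _) (ltW (hN N n (leqnn N)))).
  rewrite mulr_sumr; apply: ler_sum => k _; rewrite -exprMn.
  by rewrite ler_sqr ?nnegrE ?mulr_ge0 ?nrm_ge0 ?cauchy_schwarz// (@nrm_ge0 _ _ K^o).
move=> /(le_trans (fA x).1); rewrite lee_fin.
have := mulr_gt0 A0 (exprn_gt0 2 x_gt0); lra.
Qed.

(** The optimal bound needs the canonical dual: other duals may have a larger
    upper bound than 1/A. *)
Lemma operator_norm_le_sqrt (T : {linear H -> H}) (f : nat -> H) (A B : R) :
  frame_with_bounds form f A B -> represents T f ->
  operator_norm T <= Num.sqrt (B * A^-1).
Proof.
move=> fAB Tf; have [A0 B0 _] := fAB.
have [g [fg gA]] := canonical_dual H_hilbert fAB.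
apply: operator_norm_le => [|x]; first exact: sqrtr_ge0.
rewrite -ler_sqr ?nnegrE ?mulr_ge0 ?sqrtr_ge0 ?nrm_ge0//.
rewrite exprMn sqr_sqrtr; last by rewrite mulr_ge0// ?invr_ge0 ltW.
rewrite -mulrA; apply: (bessel_synthesis_bound H_hilbert B0
  (bessel_shift (frame_bessel fAB)) (gA x)).
exact: represents_expansion Tf fg.
Qed.

End OperatorNorm.

(** * Characterizations of representability *)

Theorem theorem2p1 (R : realType) (F : scalar_kind)
    (H : completeNormedModType (scalar_field R F))
    (form : {dot H for @scalar_conj R F})
    (H_hilbert : hilbert_norm form)
    (H_separable : separable_space H)
    (H_infinite : infinite_dimensional H)
    (f : nat -> H) (A B : R)
    (f_frame : frame_with_bounds form f A B) :
  let cond_i := exists T : {linear H -> H}, represents T f in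
  let shifted_expansion (g : nat -> H) := forall j : nat,
    has_sum (fun k => form (f j) (g k) *: f k.+1) (f j.+1) in
  let cond_ii_some :=
    exists g : nat -> H, dual_frame form f g /\ shifted_expansion g in
  let cond_ii_all :=
    forall g : nat -> H, dual_frame form f g -> shifted_expansion g in
  let cond_iii :=
    @right_shift R F @` synthesis_kernel f `<=` synthesis_kernel f in
  [/\ cond_i <-> cond_ii_some,
      cond_ii_some <-> cond_ii_all,
      cond_i <-> cond_iii &
      forall T : {linear H -> H}, represents T f ->
        (forall g : nat -> H, dual_frame form f g ->
          forall x : H, has_sum (fun k => form x (g k) *: f k.+1) (T x)) /\
        1 <= operator_norm T <= Num.sqrt (B * A^-1)].
Proof.
move=> cond_i shifted_expansion cond_ii_some cond_ii_all cond_iii.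
have [_ B0 _] := f_frame.
have fB := frame_bessel f_frame.
have [g [fg _]] := canonical_dual H_hilbert f_frame.
have i_all : cond_i -> cond_ii_all.
  move=> [T Tf] h fh j; rewrite (represents_step _ Tf).
  exact: represents_expansion.
have all_some : cond_ii_all -> cond_ii_some by move=> h; exists g; split; auto.
have some_i : cond_ii_some -> cond_i.
  move=> [h [fh hj]]; exact: (shifted_expansion_represents H_hilbert B0 fB fh hj).
split.
- by split=> [/i_all/all_some|/some_i].
- by split=> [/some_i/i_all|/all_some].
- split=> [[T Tf]|kerT]; first exact: represents_kernel Tf.
  apply: some_i; exists g; split=> //.
  exact: kernel_shifted_expansion.
- move=> T Tf; split=> [h fh x|]; first exact: represents_expansion.
  by rewrite (operator_norm_ge1 H_hilbert H_infinite f_frame Tf)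
    (operator_norm_le_sqrt H_hilbert f_frame Tf).
Qed.
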